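(* Let $0\le\lambda_1\le\lambda_2\le\cdots$, with $\lambda_n\to\infty$, be the eigenvalues, repeated with multiplicity, of the Laplace operator on a Riemannian manifold. Let $N(\lambda)=\#\{n:\lambda_n<\lambda\}$ be the counting function, and let $K(t)=\sum_{n}e^{-\lambda_n t}$ be the heat kernel, assumed to converge for every $t>0$. Then for every $t>0$, $$K(t)=t\int_0^\infty N(\lambda)\,e^{-\lambda t}\,d\lambda .$$
   Context: The Laplace operator is taken with the sign convention that makes it nonnegative, and its spectrum is the discrete sequence $\{\lambda_n\}_{n\ge1}$ of eigenvalues listed with multiplicity. The counting function $N(\lambda)$ is the number of eigenvalues (with multiplicity) smaller than $\lambda$. ''Heat kernel'' here means the function $K(t)=\sum_n e^{-\lambda_n t}$ of $t$ (the heat trace). *)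

(* Defs.v *)
(* MathComp-Analysis, over an arbitrary [R : realType]. *)
From mathcomp Require Import all_boot all_order all_algebra.
From mathcomp Require Import all_classical all_reals all_analysis.
Set Implicit Arguments.
Unset Strict Implicit.
Unset Printing Implicit Defensive.
Import Order.TTheory GRing.Theory Num.Theory.
Import numFieldNormedType.Exports.
Local Open Scope classical_set_scope.
Local Open Scope ring_scope.

(* The index [n : nat] stands for the (n+1)-st eigenvalue. Counting indices
   rather than values takes multiplicities into account. [counting] takes the
   value [+oo] on infinite sets; when [lam] tends to [+oo] this never occurs. *)
Definition counting_function (R : realType) (lam : R^nat) (x : R) : \bar R :=
  counting [set n | lam n < x].

Definition heat_series (R : realType) (lam : R^nat) (t : R) : R^nat :=
  series (fun n => expR (- lam n * t)).

Definition heat_kernel (R : realType) (lam : R^nat) (t : R) : R :=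
  limn (heat_series lam t).

(* Main.v *)
(* The counting function is the sum over n of the indicators of `]lam n, +oo[,
   and t times the integral of exp(- x t) over this ray is exp(- lam n t); sum
   and integral commute by monotone convergence since all terms are >= 0. *)
Require Import Defs.
From mathcomp Require Import all_boot all_order all_algebra.
From mathcomp Require Import all_classical all_reals all_analysis.
From mathcomp Require Import measurable_realfun.
Set Implicit Arguments.
Unset Strict Implicit.
Unset Printing Implicit Defensive.
Import Order.TTheory GRing.Theory Num.Theory.
Import numFieldNormedType.Exports.
Local Open Scope classical_set_scope.
Local Open Scope ring_scope.

Lemma continuous_expRN (R : realType) (t : R) :
  continuous (fun x : R => expR (- x * t)).
Proof.
move=> x; apply: continuous_comp; last exact: continuous_expR.
by apply: cvgMr_tmp; apply: cvgN; exact: cvg_id.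
Qed.

(** The primitive [- t^-1 * expR (- x * t)] tends to 0 at infinity because [0 < t], so only its
    value at [a] contributes, and the factor [t] cancels [t^-1]. *)
Lemma integral_expR_ray (R : realType) (a t : R) : 0 < t ->
  (t%:E * \int[lebesgue_measure]_(x in `]a, +oo[) (expR (- x * t))%:E)%E =
  (expR (- a * t))%:E.
Proof.
move=> t0.
have cf := @continuous_expRN R t.
have cF : continuous (fun x : R => - t^-1 * expR (- x * t)).
  by move=> x; apply: cvgMl_tmp; exact: cf.
have dF (x : R) : is_derive x 1 (fun x : R => - t^-1 * expR (- x * t))
    (expR (- x * t)).
  have -> : (fun x : R => - t^-1 * expR (- x * t)) =
      (- t^-1) \*: (expR \o (fun x : R => (- t) *: x)).
    by apply/funext => y; congr (_ * expR _);
      rewrite /GRing.scale/= !mulNr mulrC.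
  apply: is_derive_eq.
  by rewrite /GRing.scale/= mulr1 mulNr mulrCA mulrN mulVf ?gt_eqF//
    mulrN1 opprK !mulNr mulrC.
(* Adding the null set [{a}] gives the closed ray to which the fundamental theorem of calculus
   applies; its last argument [0] is the limit of the primitive. *)
rewrite integral_itv_obnd_cbnd; last first.
  apply/measurable_EFinP/measurable_funTS.
  exact: continuous_measurable_fun.
rewrite (@ge0_continuous_FTC2y _ _ (fun x : R => - t^-1 * expR (- x * t)) _ 0).
- by rewrite sub0e -EFinN -EFinM mulNr opprK mulrA divff ?gt_eqF// mul1r.
- by move=> x _; exact: expR_ge0.
- exact: continuous_subspaceT.
- rewrite -[X in _ --> X](mulr0 (- t^-1)); apply: cvgMr.
  under eq_fun do rewrite mulNr.
  apply: (@cvg_comp _ _ _ (fun x => x * t) (fun z => expR (- z)));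
    last exact: cvgr_expR.
  exact: gt0_cvgMly.
- by move=> x _; apply: ex_derive.
- by apply: cvg_at_right_filter; exact: cF.
- by move=> x _; rewrite derive1E derive_val.
Qed.

Theorem theorem1 (R : realType) (lam : R^nat)
  (lam_ge0 : forall n, 0 <= lam n)
  (lam_nd : nondecreasing_seq lam)
  (lam_infty : lam n @[n --> \oo] --> +oo)
  (heat_cvg : forall t : R, 0 < t -> cvgn (heat_series lam t))
  (t : R) (t_gt0 : 0 < t) :
  (heat_kernel lam t)%:E =
  (t%:E * \int[lebesgue_measure]_(x in `[0%R, +oo[)
            (counting_function lam x * (expR (- x * t))%:E))%E.
Proof.
(* The ray is open at [lam n] because eigenvalues are counted with strict inequality. *)
pose f n (x : R) : \bar R :=
  ((expR (- x * t))%:E * (\1_`]lam n, +oo[ x)%:E)%E.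
have mexp : measurable_fun [set: R] (fun x : R => (expR (- x * t))%:E).
  apply/measurable_EFinP; apply: continuous_measurable_fun.
  exact: continuous_expRN.
have f0 n x : (0 <= f n x)%E by rewrite mule_ge0// lee_fin ?expR_ge0.
have mf n : measurable_fun [set: R] (f n).
  apply: emeasurable_funM => //; apply/measurable_EFinP.
  exact: measurable_indic.
have fE x : (counting_function lam x * (expR (- x * t))%:E =
    \sum_(n <oo) f n x)%E.
  (* Counting measure is the sum of the Dirac masses at all [n]; the mass at [n] of the set of
     indices with [lam n < x] is the indicator of the ray at [x]. *)
  rewrite nneseriesZl// muleC /counting_function counting_dirac; congr (_ * _)%E.
  apply: eq_eseriesr => n _; rewrite diracE indicE.
  by congr (_%:R%:E); congr nat_of_bool; apply/idP/idP;
    rewrite !inE /= in_itv/= andbT.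
under eq_integral do rewrite fE.
rewrite integral_nneseries//; last first.
  by move=> n; exact: (measurable_funTS (mf n)).
rewrite -nneseriesZl; last by move=> n _; exact: integral_ge0.
(* Convergence of the heat series lets its real limit be taken in [\bar R]; the partial sums on both
   sides then agree term by term. *)
rewrite /heat_kernel -EFin_lim; last exact: heat_cvg.
apply/congr_lim/funext => N /=; rewrite -sumEFin; apply: eq_bigr => n _.
rewrite -(integral_expR_ray _ t_gt0); congr (_ * _)%E.
(* Since [0 <= lam n], restricting the domain to [[0, +oo[] cuts nothing off the ray, so the
   integral against the indicator is the one over the whole ray. *)
have -> : `]lam n, +oo[%classic = (`[0, +oo[ : set R) `&` `]lam n, +oo[.
  apply/seteqP; split => x /=; rewrite !in_itv/= !andbT; last by case.
  by move=> lx; split => //; rewrite (le_trans (lam_ge0 n))// ltW.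
rewrite integral_mkcondr; apply: eq_integral => x _.
by rewrite epatch_indic.
Qed.
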